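(* Let $\lambda\in(0,1]$ and $T\in\mathbb{B}(\mathcal{H})$. Then $P_{\lambda}(T)=T$ if and only if $T$ is quasinormal.
   Context: $\mathbb{B}(\mathcal{H})$ denotes the bounded linear operators on a complex Hilbert space $\mathcal{H}$. $T$ is quasinormal if $T(T^{*}T)=(T^{*}T)T$. Every $T\in\mathbb{B}(\mathcal{H})$ has a unique polar decomposition $T=U|T|$, where $|T|=(T^{*}T)^{1/2}$ and $U$ is a partial isometry with $\mathcal{N}(U)=\mathcal{N}(T)$. The Duggal transform is $T^{D}=|T|U$, the Aluthge transform is $\Delta(T)=|T|^{1/2}U|T|^{1/2}$, and for $\lambda\in[0,1]$ the power mean transform is $P_{\lambda}(T)=(1-\lambda)^2T+\lambda^2T^{D}+2\lambda(1-\lambda)\Delta(T)$. *)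

(* Defs.v *)
From HB Require Import structures.
From mathcomp Require Import all_boot all_order all_algebra.
From mathcomp Require Import sesquilinear complex.
From mathcomp Require Import all_classical all_reals all_analysis.

Set Implicit Arguments.
Unset Strict Implicit.
Unset Printing Implicit Defensive.

Import Order.TTheory GRing.Theory Num.Theory.
Import numFieldNormedType.Exports.

Local Open Scope classical_set_scope.
Local Open Scope ring_scope.
Local Open Scope complex_scope.

(* The inner product is linear in its first argument and conjugate-linear in
   the second one. *)
HB.mixin Record isHilbert (R : realType) H
    of CompleteNormedModule R[i] H := {
  inner : {dot H for (@Num.conj R[i])} ;
  inner_normE : forall x : H, inner x x = `|x| ^+ 2
}.

#[short(type="hilbertType")]
HB.structure Definition Hilbert (R : realType) :=
  {H of CompleteNormedModule R[i] H & isHilbert R H}.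

Section BoundedOperators.
Context {R : realType} {H : hilbertType R}.

Definition bounded_linear : {pred H -> H} :=
  mem [set f : H -> H | linear f /\ bounded_near f (nbhs (0 : H))].

Lemma bounded_linearP (f : H -> H) :
  reflect (linear f /\ continuous f) (f \in bounded_linear).
Proof.
apply: (iffP idP); rewrite !inE /= => -[lf fb]; split=> //.
  pose g : {linear H -> H} :=
    HB.pack f (GRing.isLinear.Build R[i] H H _ f lf).
  exact: (@bounded_linear_continuous _ _ _ g).
pose g : {linear H -> H} := HB.pack f (GRing.isLinear.Build R[i] H H _ f lf).
by have /linear_bounded_continuous := fb : continuous g.
Qed.

Lemma bounded_linear_submod : submod_closed bounded_linear.
Proof.
split=> [|a f g /bounded_linearP[lf cf] /bounded_linearP[lg cg]].
  apply/bounded_linearP; split=> [a x y|x]; last exact: cst_continuous.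
  by rewrite scaler0 addr0.
apply/bounded_linearP; split=> [b x y|x].
  rewrite !fctE lf lg !scalerDr !scalerA mulrC.
  by rewrite addrACA.
by apply: continuousD; [apply: continuousZr; exact: cf|exact: cg].
Qed.

HB.instance Definition _ :=
  GRing.isSubmodClosed.Build R[i] (H -> H) bounded_linear bounded_linear_submod.

End BoundedOperators.

Structure bounded_op (R : realType) (H : hilbertType R) := BoundedOp {
  bounded_op_fun :> H -> H ;
  _ : bounded_op_fun \in bounded_linear }.

Notation "''B' ( H )" := (bounded_op H) (at level 8, format "''B' ( H )").

HB.instance Definition _ (R : realType) (H : hilbertType R) :=
  [isSub for @bounded_op_fun R H].
HB.instance Definition _ (R : realType) (H : hilbertType R) :=
  [Choice of 'B(H) by <:].
HB.instance Definition _ (R : realType) (H : hilbertType R) :=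
  [SubChoice_isSubLmodule of 'B(H) by <:].

Section OperatorRing.
Context {R : realType} {H : hilbertType R}.
Implicit Types S T : 'B(H).

Lemma bounded_op_linear T : linear T.
Proof. by have /bounded_linearP[] := valP T. Qed.

HB.instance Definition _ T :=
  GRing.isLinear.Build R[i] H H _ T (bounded_op_linear T).

Lemma bounded_op_continuous T : continuous T.
Proof. by have /bounded_linearP[] := valP T. Qed.

Lemma bounded_opP S T : S =1 T -> S = T.
Proof. by move=> /funext ST; apply: val_inj. Qed.

Lemma id_bounded_linear : (id : H -> H) \in bounded_linear.
Proof. by apply/bounded_linearP; split=> // x; exact: cvg_id. Qed.

Lemma comp_bounded_linear S T : (S \o T) \in bounded_linear.
Proof.
apply/bounded_linearP; split=> [a x y|x]; first by rewrite /= !linearP.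
by apply: continuous_comp; exact: bounded_op_continuous.
Qed.

Definition op_id : 'B(H) := BoundedOp id_bounded_linear.
Definition op_comp S T : 'B(H) := BoundedOp (comp_bounded_linear S T).

Lemma op_compA : associative op_comp.
Proof. by move=> S T U; exact: bounded_opP. Qed.
Lemma op_comp1l : left_id op_id op_comp.
Proof. by move=> S; exact: bounded_opP. Qed.
Lemma op_comp1r : right_id op_id op_comp.
Proof. by move=> S; exact: bounded_opP. Qed.
Lemma op_compDl : left_distributive op_comp +%R.
Proof. by move=> S T U; exact: bounded_opP. Qed.
Lemma op_compDr : right_distributive op_comp +%R.
Proof. by move=> S T U; apply: bounded_opP => x /=; rewrite linearD. Qed.

End OperatorRing.

(* In 'B(H), [*] is composition of operators and [1] is the identity. *)
HB.instance Definition _ (R : realType) (H : hilbertType R) :=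
  GRing.Zmodule_isPzRing.Build 'B(H)
    op_compA op_comp1l op_comp1r op_compDl op_compDr.

Section Transforms.
Context {R : realType} {H : hilbertType R}.
Implicit Types (S T A B U : 'B(H)) (x y : H).

Definition is_adjoint T S := forall x y, inner (T x) y = inner x (S y).

(* [xget 0 P] is an element of [P] when there is one: the adjoint, the positive
   square root of a positive operator and the polar decomposition always exist
   and are unique, so the default value 0 is not reached for them. *)
Definition adjoint T : 'B(H) := xget 0 [set S | is_adjoint T S].

Definition positive_op A := forall x, 0 <= inner (A x) x.

Definition op_sqrt A : 'B(H) := xget 0 [set B | positive_op B /\ B * B = A].

Definition op_abs T : 'B(H) := op_sqrt (adjoint T * T).

Definition op_ker T : set H := [set x | T x = 0].

Definition orthogonal_compl (V : set H) : set H :=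
  [set x | forall y, V y -> inner x y = 0].

Definition partial_isometry U :=
  forall x, orthogonal_compl (op_ker U) x -> `|U x| = `|x|.

Definition polar_part T : 'B(H) :=
  xget 0 [set U | [/\ partial_isometry U, op_ker U = op_ker T
                    & T = U * op_abs T]].

Definition quasinormal T := T * (adjoint T * T) = (adjoint T * T) * T.

Definition duggal T : 'B(H) := op_abs T * polar_part T.

Definition aluthge T : 'B(H) :=
  op_sqrt (op_abs T) * polar_part T * op_sqrt (op_abs T).

Definition power_mean (lam : R) T : 'B(H) :=
  ((1 - lam) ^+ 2)%:C *: T + (lam ^+ 2)%:C *: duggal T
  + (2 * lam * (1 - lam))%:C *: aluthge T.

End Transforms.

(* Main.v *)
(* Write T = U|T| and A = |T|^(1/2). With L and M the left and right
   multiplications by A, P_lam(T) = T reads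
   lam (L - M)((2 - lam) M + lam L) U = 0, so D = AU - UA satisfies
   (2 - lam) DA + lam AD = 0. Taking adjoints, A commutes with D^*D, hence so
   does B = A^(1/2), and (2 - lam) |DBx|^2 = - lam <ADx, Dx> <= 0. Thus DA = 0;
   since D also vanishes on ker A, D = 0 and T commutes with T^*T. Conversely,
   a quasinormal T commutes with |T| and A, which forces U to commute with A,
   and the three summands are multiples of T with coefficients of sum 1. *)
From HB Require Import structures.
Require Import Defs.
From mathcomp Require Import all_boot all_order all_algebra.
From mathcomp Require Import sesquilinear complex.
From mathcomp Require Import all_classical all_reals all_analysis.
From mathcomp Require Import ring lra.

Set Implicit Arguments.
Unset Strict Implicit.
Unset Printing Implicit Defensive.

Import Order.TTheory GRing.Theory Num.Theory.
Import numFieldNormedType.Exports.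

Local Open Scope classical_set_scope.
Local Open Scope ring_scope.

(** * Inner product, strong limits of operators, Riesz representation and adjoints *)

Section HilbertSpace.
Context (R : realType) (H : hilbertType R).
Implicit Types (x y z : H) (T : 'B(H)) (u : nat -> H).

Lemma innerC x y : inner x y = (inner y x)^*.
Proof. by rewrite hermC /= mul1r. Qed.

Lemma innerDl x y z : inner (x + y) z = inner x z + inner y z.
Proof. by rewrite linearDl. Qed.

Lemma innerDr x y z : inner z (x + y) = inner z x + inner z y.
Proof. by rewrite linearDr. Qed.

Lemma innerBl x y z : inner (x - y) z = inner x z - inner y z.
Proof. by rewrite linearBl. Qed.

Lemma innerBr x y z : inner z (x - y) = inner z x - inner z y.
Proof. by rewrite linearBr. Qed.

Lemma innerZl (a : R[i]) y z : inner (a *: y) z = a * inner y z.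
Proof. by rewrite linearZl_LR. Qed.

Lemma innerZr (a : R[i]) y z : inner z (a *: y) = a^* * inner z y.
Proof. by rewrite linearZr_LR. Qed.

Lemma inner0r x : inner x 0 = 0.
Proof. by rewrite linear0r. Qed.

Lemma inner0l x : inner 0 x = 0.
Proof. by rewrite innerC inner0r conjC0. Qed.

Lemma inner_ge0 x : 0 <= inner x x.
Proof. exact: dnorm_ge0. Qed.

Lemma inner_eq0 x : inner x x = 0 -> x = 0.
Proof. by move/eqP; rewrite dnorm_eq0 => /eqP. Qed.

Lemma inner_ext x y : (forall z, inner x z = inner y z) -> x = y.
Proof.
by move=> xy; apply/eqP; rewrite -subr_eq0; apply/eqP/inner_eq0;
  rewrite innerBl xy subrr.
Qed.

Lemma cauchy_schwarz x y : `|inner x y| <= `|x| * `|y|.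
Proof.
have [->|y0] := eqVneq y 0; first by rewrite !inner0r !normr0 mulr0.
have yy : 0 < inner y y by rewrite dnorm_gt0.
rewrite -(@ler_pXn2r _ 2) ?nnegrE ?mulr_ge0// exprMn -!inner_normE normCK.
rewrite -subr_ge0 -(pmulr_rge0 _ yy).
(* The squared norm of this vector expands to exactly the product in the goal. *)
have := inner_ge0 (inner y y *: x - inner x y *: y).
rewrite !(innerBl, innerBr, innerZl, innerZr) -(innerC y y) (innerC y x).
by congr (0 <= _); ring.
Qed.


Definition selfadjoint T := is_adjoint T T.

Lemma op_bound T : exists2 M : R, 0 < M & forall x, `|T x| <= M%:C%C * `|x|.
Proof.
have [M [Mr TM]] := (linear_boundedP _).1
  ((linear_bounded_continuous _).2 (@bounded_op_continuous _ _ T)).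
have /complex_realP[m Mm] := Mr.
(* [linear_boundedP] gives the bound for every constant strictly above [M]; this one is also
   positive. *)
exists (`|m| + 1) => [|x]; first by rewrite ltr_wpDl.
by apply: TM; rewrite Mm ltcR (le_lt_trans (ler_norm m))// ltrDl.
Qed.

Lemma bounded_op_of (f : H -> H) (M : R) : linear f ->
  (forall x, `|f x| <= M%:C%C * `|x|) -> exists T : 'B(H), T =1 f.
Proof.
move=> lf fM.
pose g : {linear H -> H} :=
  HB.pack f (GRing.isLinear.Build R[i] H H _ f lf).
have fb : f \in @bounded_linear R H.
  rewrite inE /=; split => //.
  apply: ((linear_boundedP g).2); exists M%:C%C; split.
    by apply/complex_realP; exists M.
  move=> k Mk x; apply: le_trans (fM x) _.
  by rewrite ler_wpM2r// ltW.
by exists (BoundedOp fb).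
Qed.

Lemma cauchy_cvg_seq u :
  (forall e : R, 0 < e -> exists N, forall n m, (N <= n)%N -> (n <= m)%N ->
     `|u m - u n| <= e%:C%C) ->
  exists x : H, u @ \oo --> x.
Proof.
move=> uC; apply/cvg_ex; apply: cauchy_cvg.
apply: cauchy_exP => e e0.
have /complex_realP[r er] : e \is Num.real by exact: gtr0_real.
have r0 : 0 < r / 2 by rewrite divr_gt0// -ltcR -er.
have [N uN] := uC _ r0; exists (u N); exists N => // n /= Nn.
rewrite -ball_normE /= distrC; apply: le_lt_trans (uN _ _ _ Nn) _ => //.
by rewrite er ltcR ltr_pdivrMr// mulr_natr mulr2n ltrDl -ltcR -er.
Qed.

Lemma cvg_seqP u x : u @ \oo --> x ->
  forall e : R[i], 0 < e -> exists N, forall n, (N <= n)%N -> `|x - u n| <= e.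
Proof.
move=> /cvgrPdist_le ux e /ux[N _ uN].
by exists N => n Nn; apply: uN.
Qed.

Lemma cvg_seq_unique u x y : u @ \oo --> x -> u @ \oo --> y -> x = y.
Proof. exact: cvg_unique. Qed.

Lemma norm_lim_le (u v : nat -> H) x y :
  u @ \oo --> x -> v @ \oo --> y -> (forall n, `|u n| <= `|v n|) ->
  `|x| <= `|y|.
Proof.
move=> ux vy uv; apply/ler_addgt0Pl => e e0.
have e2 : 0 < e / 2 by rewrite divr_gt0.
have [N1 h1] := cvg_seqP ux e2; have [N2 h2] := cvg_seqP vy e2.
have {}h1 := h1 _ (leq_maxl N1 N2); have {}h2 := h2 _ (leq_maxr N1 N2).
set n := maxn N1 N2 in h1 h2.
rewrite -(subrK (u n) x) (le_trans (ler_normD _ _))// [e]splitr -addrA lerD//.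
rewrite (le_trans (uv n))// -(subrK y (v n)) (le_trans (ler_normD _ _))//.
by rewrite distrC lerD2r.
Qed.

Lemma norm_lim_eq (u v : nat -> H) x y :
  u @ \oo --> x -> v @ \oo --> y -> (forall n, `|u n| = `|v n|) ->
  `|x| = `|y|.
Proof.
move=> ux vy uv; apply/eqP; rewrite eq_le.
by rewrite (norm_lim_le ux vy) ?(norm_lim_le vy ux)// => n; rewrite uv.
Qed.

(** Once [y] is within [e ^+ 2] of its supremum, all later squared increments of [u] are below
    [e ^+ 2]. This serves both the square root iteration and the powers of a contraction. *)
Lemma cvg_seq_telescope u (y : nat -> R) (b : R) :
  (forall n m, (n <= m)%N -> y n <= y m) -> (forall n, y n <= b) ->
  (forall n m, (n <= m)%N -> `|u m - u n| ^+ 2 <= (y m - y n)%:C%C) ->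
  exists x : H, u @ \oo --> x.
Proof.
move=> y_homo yb uy; apply: cauchy_cvg_seq => e e0.
have Ey : has_sup (range y).
  by split; [exists (y 0%N), 0%N|exists b => _ [n _ <-]].
have [_ [N _ <-] Ny] := sup_adherent (exprn_gt0 2 e0) Ey.
exists N => n m Nn nm.
rewrite -(@ler_pXn2r _ 2) ?nnegrE ?ler0c ?(ltW e0)//.
apply: le_trans (uy _ _ nm) _; rewrite -rmorphXn lecR lerBlDr.
apply: le_trans (lerD (lexx _) (y_homo _ _ Nn)).
rewrite -lerBlDl; apply: le_trans (ltW Ny); rewrite lerD2r.
by apply: (ub_le_sup Ey.2); exists m.
Qed.

Lemma strong_limit (S : nat -> 'B(H)) (M : R) :
  (forall n x, `|S n x| <= M%:C%C * `|x|) ->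
  (forall x, exists l : H, S n x @[n --> \oo] --> l) ->
  exists L : 'B(H), forall x, S n x @[n --> \oo] --> L x.
Proof.
move=> SM /choice[f Sf].
have lf : linear f.
  move=> a x y; apply: (cvg_seq_unique (Sf _)).
  rewrite (_ : (fun n => _) = fun n => a *: S n x + S n y); last first.
    by apply/funext => n; rewrite linearP.
  by apply: cvgD => //; apply: cvgZr.
have fM x : `|f x| <= M%:C%C * `|x|.
  apply/ler_addgt0Pl => e e0; have [N /(_ N (leqnn N)) fN] := cvg_seqP (Sf x) e0.
  by rewrite -(subrK (S N x) (f x)) (le_trans (ler_normD _ _))// lerD.
have [L Lf] := bounded_op_of lf fM.
by exists L => x; rewrite Lf.
Qed.

Lemma limit_selfadjoint (S : nat -> 'B(H)) (L : 'B(H)) :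
  (forall n, selfadjoint (S n)) -> (forall x, S n x @[n --> \oo] --> L x) ->
  selfadjoint L.
Proof.
move=> Ss SL x y; apply/eqP; rewrite -subr_eq0 -normr_le0.
apply/ler_addgt0Pl => e e0; rewrite addr0.
(* The two errors add up to at most [e] times [|x| + |y|] over this number; the [+ 1] keeps it
   positive when both vectors vanish. *)
have k0 : 0 < `|x| + `|y| + 1 by rewrite ltr_wpDl ?addr_ge0.
have [N xN] := cvg_seqP (SL x) (divr_gt0 e0 k0).
have [N' yN] := cvg_seqP (SL y) (divr_gt0 e0 k0).
have {}xN := xN _ (leq_maxl N N'); have {}yN := yN _ (leq_maxr N N').
set n := maxn N N' in xN yN.
rewrite (_ : _ - _ = inner (L x - S n x) y - inner x (L y - S n y)); last first.
  by rewrite innerBl innerBr (Ss n); ring.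
rewrite (le_trans (ler_normB _ _))//.
have h1 := le_trans (cauchy_schwarz (L x - S n x) y) (ler_wpM2r (normr_ge0 y) xN).
have h2 := le_trans (cauchy_schwarz x (L y - S n y)) (ler_wpM2l (normr_ge0 x) yN).
apply: le_trans (lerD h1 h2) _.
rewrite [leLHS](_ : _ = e * ((`|x| + `|y|) / (`|x| + `|y| + 1))); last by ring.
by rewrite ler_piMr ?(ltW e0)// ler_pdivrMr// mul1r lerDl.
Qed.

(** The representing vector minimises [G z = |z|^2 - 2 Re (phi z)]. By [key], a vector where [G] is
    nearly minimal nearly represents [phi]; a suitable minimising sequence is therefore Cauchy, and
    its limit represents [phi] exactly. *)
Lemma riesz (phi : H -> R[i]) (M : R) : scalar phi ->
  (forall x, `|phi x| <= M%:C%C * `|x|) ->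
  exists z, forall x, phi x = inner x z.
Proof.
move=> lphi phiM.
have real_addC (w : R[i]) : w + w^* \is Num.real.
  by rewrite CrealE rmorphD /= conjCK addrC.
pose G z := inner z z - (phi z + (phi z)^*).
have GF z : (complex.Re (G z))%:C%C = G z.
  by apply: RRe_real; rewrite rpredB// ger0_real// inner_ge0.
pose E := range (fun z => complex.Re (G z)).
have E_inf : has_inf E.
  split; first by exists (complex.Re (G 0)), 0.
  (* Completing the square: [|z|^2 - 2 M |z| >= - M^2]. *)
  exists (- M ^+ 2) => _ [z _ <-]; rewrite -lecR GF.
  have phi_le : phi z + (phi z)^* <= 2 * (M%:C%C * `|z|).
    apply: le_trans (real_ler_norm _) _ => //.
    rewrite (le_trans (ler_normD _ _))// norm_conjC -mulr2n -[leLHS]mulr_natl.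
    by rewrite ler_wpM2l.
  apply: le_trans (lerB (lexx _) phi_le).
  rewrite inner_normE -(RRe_real (normr_real z)).
  rewrite [leRHS](_ : _ = (complex.Re `|z| ^+ 2 - 2 * (M * complex.Re `|z|))%:C%C).
    rewrite lecR; have := sqr_ge0 (complex.Re `|z| - M); lra.
  by rewrite rmorphB rmorphXn !rmorphM /= rmorph_nat.
set d := inf E.
have key z x : `|inner x z - phi x| ^+ 2 <= (G z - d%:C%C) * `|x| ^+ 2.
  have [->|x0] := eqVneq x 0.
    have : `|phi 0| <= 0 by rewrite (le_trans (phiM 0))// normr0 mulr0.
    by rewrite normr_le0 => /eqP ->; rewrite inner0l subr0 !normr0 !expr0n mulr0.
  have xx : 0 < inner x x by rewrite dnorm_gt0.
  set w := inner x z - phi x.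
  pose s := (inner x x)^-1.
  have sJ : s^* = s by apply/CrealP; rewrite realV ger0_real ?inner_ge0.
  (* This [t] minimises [G (z - t x)]; the minimum is [G z - |w|^2 / |x|^2], and it is at least
     [d]. *)
  pose t := s * w^*.
  pose v := - t *: x + z.
  have dGv : d%:C%C <= G v.
    by rewrite -GF lecR; apply: ge_inf; [exact: E_inf.2 | exists v].
  rewrite -inner_normE -ler_pdivrMr// -/s lerBrDr -lerBrDl.
  apply: le_trans dGv _; rewrite le_eqVlt; apply/orP; left; apply/eqP.
  rewrite /G /v lphi !(innerDl, innerDr, innerZl, innerZr) (innerC z x) normCK.
  rewrite !(rmorphD, rmorphN, rmorphM) /= !conjCK sJ.
  rewrite /t /w !(rmorphD, rmorphN) /= /s; field.
  by rewrite gt_eqF.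
pose e n : R := n.+1%:R^-1.
have /choice[z zP] : forall n, exists z, forall x, `|inner x z - phi x| <= (e n)%:C%C * `|x|.
  move=> n.
  have en : 0 < e n by rewrite invr_gt0.
  (* Since [key] bounds a square, [G z] is taken within [e n ^+ 2] of the infimum. *)
  have [_ [z _ <-] zd] := inf_adherent (exprn_gt0 2 en) E_inf.
  exists z => x.
  have enC : 0 <= (e n)%:C%C by rewrite ler0c ltW.
  rewrite -(@ler_pXn2r _ 2) ?nnegrE ?mulr_ge0// exprMn.
  apply: le_trans (key z x) _; rewrite ler_wpM2r ?exprn_ge0//.
  by rewrite lerBlDl -GF -rmorphXn -rmorphD lecR ltW.
have small (r : R) : 0 < r -> exists N, forall n, (N <= n)%N -> e n <= r.
  move=> r0; have [N _ rN] := near_infty_natSinv_lt (PosNum r0).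
  by exists N => n /rN /ltW.
have [l zl] : exists l : H, z @ \oo --> l.
  apply: cauchy_cvg_seq => r r0.
  have [N Nr] := small _ (divr_gt0 r0 (ltr0Sn R 1)).
  exists N => n m Nn nm.
  have [->|zmn] := eqVneq (z m) (z n); first by rewrite subrr normr0 ler0c ltW.
  rewrite -subr_eq0 -normr_gt0 in zmn.
  (* Testing against [x = z m - z n]: [inner x x] is the difference of the errors of [z m] and [z n]
     as representatives of [phi], hence at most [(e m + e n) |x|]. *)
  rewrite -(ler_pM2r zmn) -expr2 -inner_normE innerBr.
  rewrite -[leLHS]ger0_norm; last by rewrite -innerBr inner_ge0.
  set x := z m - z n.
  rewrite (_ : _ - _ = (inner x (z m) - phi x) - (inner x (z n) - phi x)); last by ring.
  rewrite (le_trans (ler_normB _ _))// (le_trans (lerD (zP _ _) (zP _ _)))//.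
  rewrite -mulrDl ler_wpM2r// -rmorphD lecR.
  by rewrite [leRHS]splitr lerD// Nr// (leq_trans Nn).
exists l => x; apply/eqP; rewrite eq_sym -subr_eq0 -normr_le0.
apply/ler_addgt0Pl => r r0; rewrite addr0.
have k0 : 0 < 2 * (`|x| + 1) by rewrite mulr_gt0// ltr_wpDl.
have dr := RRe_real (gtr0_real (divr_gt0 r0 k0)).
have [N lN] := cvg_seqP zl (divr_gt0 r0 k0).
have [|N' eN'] := small (complex.Re (r / (2 * (`|x| + 1)))).
  by rewrite -ltcR dr divr_gt0.
have {}lN := lN _ (leq_maxl N N'); have {}eN' := eN' _ (leq_maxr N N').
set n := maxn N N' in lN eN'.
rewrite -lecR dr in eN'.
rewrite (_ : _ - _ = inner x (l - z n) + (inner x (z n) - phi x)); last first.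
  by rewrite innerBr; ring.
rewrite (le_trans (ler_normD _ _))//.
have h1 := le_trans (cauchy_schwarz x (l - z n)) (ler_wpM2l (normr_ge0 x) lN).
have h2 := le_trans (zP n x) (ler_wpM2r (normr_ge0 x) eN').
apply: le_trans (lerD h1 h2) _.
rewrite [leLHS](_ : _ = r * (`|x| / (`|x| + 1))); last first.
  by field; rewrite gt_eqF// ltr_wpDl.
by rewrite ler_piMr ?(ltW r0)// ler_pdivrMr ?ltr_wpDl// mul1r lerDl.
Qed.

Lemma adjoint_exists T : exists S : 'B(H), is_adjoint T S.
Proof.
have [M M0 TM] := op_bound T.
have /choice[S TS] : forall y, exists z, forall x, inner (T x) y = inner x z.
  move=> y.
  apply: (@riesz _ (M * complex.Re `|y|)) => [a x x'|x].
    by rewrite linearP innerDl innerZl.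
  rewrite (le_trans (cauchy_schwarz _ _))// rmorphM /= RRe_real//.
  by rewrite mulrAC ler_wpM2r.
have lS : linear S.
  move=> a y y'; apply: inner_ext => x.
  rewrite innerC -TS innerDr innerZr.
  by rewrite innerDl innerZl (innerC (S y)) (innerC (S y')) -!TS rmorphD rmorphM /= conjCK.
(* [|S y|^2 = <T (S y), y> <= M |S y| |y|], then cancel [|S y|]. *)
have SM y : `|S y| <= M%:C%C * `|y|.
  have [->|Sy0] := eqVneq (S y) 0.
    by rewrite normr0 mulr_ge0// ler0c ltW.
  rewrite -(ler_pM2l (_ : 0 < `|S y|)) ?normr_gt0//.
  rewrite -expr2 -inner_normE -TS.
  rewrite -[leLHS]ger0_norm; last by rewrite TS inner_ge0.
  rewrite (le_trans (cauchy_schwarz _ _))//.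
  by rewrite mulrCA mulrA ler_wpM2r// mulrC mulrC.
have [L LS] := bounded_op_of lS SM.
by exists L => x y; rewrite LS.
Qed.

Lemma adjointP T : is_adjoint T (adjoint T).
Proof.
by have [S TS] := adjoint_exists T; rewrite /adjoint; case: xgetP => //= /(_ S).
Qed.

End HilbertSpace.

(** * Positive operators *)

Section PositiveOperators.
Context (R : realType) (H : hilbertType R).
Implicit Types (x y z : H) (S T A B K Z : 'B(H)).

Lemma op_mulE S T x : (S * T) x = S (T x). Proof. by []. Qed.
Lemma op_addE S T x : (S + T) x = S x + T x. Proof. by []. Qed.
Lemma op_oppE T x : (- T) x = - T x. Proof. by []. Qed.
Lemma op_scaleE a T x : (a *: T) x = a *: T x. Proof. by []. Qed.
Lemma op_oneE x : (1 : 'B(H)) x = x. Proof. by []. Qed.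
Lemma op_zeroE x : (0 : 'B(H)) x = 0. Proof. by []. Qed.
Definition opE := (op_mulE, op_addE, op_oppE, op_scaleE, op_oneE, op_zeroE).

Lemma opD T x y : T (x + y) = T x + T y. Proof. exact: linearD. Qed.
Lemma opB T x y : T (x - y) = T x - T y. Proof. exact: linearB. Qed.
Lemma opN T x : T (- x) = - T x. Proof. exact: linearN. Qed.
Lemma opZ T a x : T (a *: x) = a *: T x. Proof. exact: linearZ. Qed.

Lemma is_adjoint_sym S T : is_adjoint T S -> is_adjoint S T.
Proof. by move=> TS x y; rewrite innerC -TS -innerC. Qed.

(** The defect [s] is sesquilinear and vanishes on the diagonal, because nonnegative complex numbers
    are real. Polarisation with [x + y] and [x + 'i *: y] then makes it vanish everywhere. *)
Lemma positive_selfadjoint A : positive_op A -> selfadjoint A.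
Proof.
move=> A0.
pose s x y := inner (A x) y - inner x (A y).
have sxx x : s x x = 0.
  rewrite /s (innerC x) [X in _ - X](_ : _ = inner (A x) x) ?subrr//.
  exact/CrealP/ger0_real/A0.
have sDl x y z : s (x + y) z = s x z + s y z.
  by rewrite /s opD !innerDl; ring.
have sDr x y z : s z (x + y) = s z x + s z y.
  by rewrite /s opD !innerDr; ring.
have sZl (a : R[i]) x y : s (a *: x) y = a * s x y.
  by rewrite /s opZ !innerZl; ring.
have sZr (a : R[i]) x y : s x (a *: y) = a^* * s x y.
  by rewrite /s opZ !innerZr; ring.
move=> x y; apply/eqP; rewrite -subr_eq0 -/(s x y).
have h1 : s x y + s y x = 0.
  by have := sxx (x + y); rewrite sDl !sDr !sxx addr0 add0r.
have h2 : 'i * (s y x - s x y) = 0.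
  have := sxx (x + 'i *: y).
  by rewrite sDl !sDr !sZl !sZr !sxx conjCi => <-; ring.
move/eqP: h2; rewrite mulf_eq0 (negPf (neq0Ci _)) /= subr_eq0 => /eqP h2.
by move/eqP: h1; rewrite h2 -mulr2n mulrn_eq0.
Qed.

Lemma positive_square S : selfadjoint S -> positive_op (S * S).
Proof. by move=> Ss x; rewrite opE Ss inner_ge0. Qed.

(** Positivity at [x - M^-1 A x] gives [0 <= <Ax, x> - 2 M^-1 |Ax|^2 + M^-2 <AAx, Ax>], and the last
    term is at most [M^-1 |Ax|^2]. *)
Lemma positive_normsq_le A (M : R) : positive_op A -> 0 < M ->
  (forall x, `|A x| <= M%:C%C * `|x|) ->
  forall x, `|A x| ^+ 2 <= M%:C%C * inner (A x) x.
Proof.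
move=> A0 M0 AM x.
have As := positive_selfadjoint A0.
have MC0 : 0 < M%:C%C by rewrite ltcR.
have MJ : (M%:C%C^-1)^* = M%:C%C^-1 :> R[i].
  by apply/CrealP; rewrite realV ger0_real// ltW.
have AAx : inner (A (A x)) (A x) <= M%:C%C * `|A x| ^+ 2.
  rewrite -[leLHS]ger0_norm ?A0// (le_trans (cauchy_schwarz _ _))//.
  by rewrite expr2 mulrA ler_wpM2r.
have := A0 (x - M%:C%C^-1 *: A x).
rewrite opB opZ !(innerBl, innerBr, innerZl, innerZr) MJ.
rewrite (As (A x) x) -!inner_normE in AAx *.
move=> h; rewrite mulrC -ler_pdivrMr// -subr_ge0; apply: le_trans h _.
rewrite -subr_ge0.
rewrite [leRHS](_ : _ = M%:C%C^-1 ^+ 2 *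
  (M%:C%C * inner (A x) (A x) - inner (A (A x)) (A x))); last first.
  by field; rewrite gt_eqF.
by rewrite mulr_ge0 ?exprn_ge0 ?invr_ge0 ?(ltW MC0)// subr_ge0.
Qed.

Lemma positive_inner_eq0 A x : positive_op A -> inner (A x) x = 0 -> A x = 0.
Proof.
move=> A0 Axx; have [M M0 AM] := op_bound A.
have := positive_normsq_le A0 M0 AM x.
by rewrite Axx mulr0 -inner_normE => Ax; apply: inner_eq0; apply/eqP;
  rewrite eq_le Ax inner_ge0.
Qed.

(** * The square root of a positive contraction *)

Section ContractionSqrt.
Context (A : 'B(H)) (A0 : positive_op A) (A1 : forall x, `|A x| <= `|x|).

(* Writing a square root of [A] as [1 - Y] turns [B * B = A] into the fixed
   point equation [Y = (K + Y * Y) / 2] with [K = 1 - A]; the scalar iteration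
   with [K] replaced by [1] majorises the operator one. *)
Let K := 1 - A.

Fixpoint sqrt_iter n : 'B(H) :=
  if n is n'.+1 then 2^-1 *: (K + sqrt_iter n' * sqrt_iter n') else 0.

Fixpoint sqrt_majorant n : R :=
  if n is n'.+1 then (1 + sqrt_majorant n' ^+ 2) / 2 else 0.

Let Y := sqrt_iter.
Let y := sqrt_majorant.

Lemma sqrt_iterS n : Y n.+1 = 2^-1 *: (K + Y n * Y n). Proof. by []. Qed.
Lemma sqrt_majorantS n : y n.+1 = (1 + y n ^+ 2) / 2. Proof. by []. Qed.

Lemma sqrt_majorant_ge0 n : 0 <= y n.
Proof. by elim: n => //= n IH; rewrite divr_ge0// addr_ge0// sqr_ge0. Qed.

Lemma sqrt_majorant_le1 n : y n <= 1.
Proof.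
elim: n => //= n IH; rewrite ler_pdivrMr// mul1r -/(y n).
by have := sqrt_majorant_ge0 n; nra.
Qed.

Lemma sqrt_majorant_homo n m : (n <= m)%N -> y n <= y m.
Proof.
apply: (homo_leq (@lexx _ _) (@le_trans _ _)) => {}n /=.
by rewrite -/(y n); have := sqr_ge0 (y n - 1); lra.
Qed.

(** [|x|^2 - |Kx|^2 = <Ax, x> + (<Ax, x> - |Ax|^2)], where both terms are nonnegative. *)
Lemma contraction_compl x : `|K x| <= `|x|.
Proof.
rewrite -(@ler_pXn2r _ 2) ?nnegrE// -!inner_normE !opE.
have A1C z : `|A z| <= 1%:C%C * `|z| by rewrite rmorph1 mul1r.
have := positive_normsq_le A0 ltr01 A1C x.
rewrite rmorph1 mul1r -inner_normE => h.
rewrite !(innerBl, innerBr) -(positive_selfadjoint A0) -subr_ge0.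
rewrite [leRHS](_ : _ = inner (A x) x + (inner (A x) x - inner (A x) (A x))).
  by rewrite addr_ge0 ?A0// subr_ge0.
by ring.
Qed.

(** Every iterate is a polynomial in [A]. In the limit, the square root commutes with whatever
    commutes with [A], which later yields its uniqueness. *)
Lemma sqrt_iter_commute Z : A * Z = Z * A -> forall n, Y n * Z = Z * Y n.
Proof.
move=> AZ; elim=> [|n IH]; first by rewrite mul0r mulr0.
apply: bounded_opP => x; rewrite sqrt_iterS !opE opZ opD opB.
have AZx : A (Z x) = Z (A x) by rewrite -!op_mulE AZ.
have YZ v : Y n (Z v) = Z (Y n v) by rewrite -!op_mulE IH.
by rewrite AZx !YZ.
Qed.

Lemma sqrt_iter_selfadjoint n : selfadjoint (Y n).
Proof.
elim: n => [|n IH] v w; first by rewrite !opE inner0l inner0r.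
rewrite sqrt_iterS !opE innerZl innerZr !(innerBl, innerBr, innerDl, innerDr).
by rewrite !IH (positive_selfadjoint A0) fmorphV /= conjC_nat.
Qed.

Lemma norm_half_le (r : R) x : `|x| <= (2 * r)%:C%C -> `|2^-1 *: x| <= r%:C%C.
Proof.
move=> xr; rewrite normrZ ger0_norm ?invr_ge0// ler_pdivrMl//.
by rewrite (le_trans xr)// rmorphM /= rmorph_nat.
Qed.

Lemma sqrt_iter_le n x : `|Y n x| <= (y n)%:C%C * `|x|.
Proof.
elim: n x => [|n IH] x; first by rewrite mul0r normr0.
have xr := RRe_real (normr_real x).
rewrite -xr -rmorphM sqrt_iterS !opE; apply: norm_half_le.
apply: le_trans (ler_normD _ _) _.
have yC0 : 0 <= (y n)%:C%C by rewrite ler0c sqrt_majorant_ge0.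
apply: le_trans (lerD (contraction_compl x)
  (le_trans (IH _) (ler_wpM2l yC0 (IH x)))) _.
rewrite -xr -!rmorphM -rmorphD lecR sqrt_majorantS.
by rewrite le_eqVlt; apply/orP; left; apply/eqP; field.
Qed.

(** For consecutive iterates, [a * a - b * b = a * (a - b) + (a - b) * b]. The scalar sequence
    factors in the same way, so the induction loses nothing. *)
Lemma sqrt_iter_succ_sub_le n x :
  `|Y n.+1 x - Y n x| <= (y n.+1 - y n)%:C%C * `|x|.
Proof.
elim: n x => [|n IH] x; have xr := RRe_real (normr_real x).
  rewrite -xr -rmorphM sqrt_iterS sqrt_majorantS [Y 0%N]/= [y 0%N]/= mulr0 !opE !(subr0, addr0).
  apply: norm_half_le; apply: le_trans (contraction_compl x) _.
  rewrite -xr lecR.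
  by rewrite le_eqVlt; apply/orP; left; apply/eqP; field.
set a := Y n.+1 in IH *; set b := Y n in IH.
have -> : Y n.+2 x - a x = 2^-1 *: (a (a x - b x) + (a (b x) - b (b x))).
  rewrite opB subrKA sqrt_iterS -/a {3}/a sqrt_iterS -/b !opE -scalerBr.
  by rewrite opprD addrACA subrr add0r.
rewrite -xr -rmorphM; apply: norm_half_le.
apply: le_trans (ler_normD _ _) _.
have ya0 : 0 <= (y n.+1)%:C%C by rewrite ler0c sqrt_majorant_ge0.
have d0 : 0 <= (y n.+1 - y n)%:C%C.
  by rewrite ler0c subr_ge0 sqrt_majorant_homo.
apply: le_trans (lerD (le_trans (sqrt_iter_le n.+1 _) (ler_wpM2l ya0 (IH x)))
  (le_trans (IH (b x)) (ler_wpM2l d0 (sqrt_iter_le n x)))) _.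
rewrite -xr -!rmorphM -rmorphD lecR (sqrt_majorantS n.+1).
rewrite le_eqVlt; apply/orP; left; apply/eqP.
have yn : y n ^+ 2 = 2 * y n.+1 - 1 by rewrite sqrt_majorantS; field.
rewrite [LHS](_ : _ = (y n.+1 ^+ 2 - y n ^+ 2) * complex.Re `|x|); last by ring.
by rewrite yn; field.
Qed.

Lemma sqrt_iter_sub_le n m x : (n <= m)%N ->
  `|Y m x - Y n x| <= (y m - y n)%:C%C * `|x|.
Proof.
elim: m => [|m IH]; first by rewrite leqn0 => /eqP ->; rewrite !subrr mul0r normr0.
rewrite leq_eqVlt => /predU1P[->|/IH{}IH]; first by rewrite !subrr mul0r normr0.
rewrite -(subrKA (Y m x)) -[(y m.+1 - y n)](subrKA (y m)) rmorphD mulrDl.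
by rewrite (le_trans (ler_normD _ _))// lerD// sqrt_iter_succ_sub_le.
Qed.

Lemma contraction_sqrt : exists B,
  [/\ positive_op B, B * B = A & forall Z, A * Z = Z * A -> B * Z = Z * B].
Proof.
have Y1 n x : `|Y n x| <= 1%:C%C * `|x|.
  by rewrite (le_trans (sqrt_iter_le n x))// ler_wpM2r// lecR sqrt_majorant_le1.
have YK x : exists l : H, Y n x @[n --> \oo] --> l.
  pose r := complex.Re `|x|; have xr : r%:C%C = `|x| by exact: RRe_real.
  (* As [y m - y n] lies between 0 and 1, its square is at most itself, so [r ^+ 2 * y n] dominates
     the squared increments. *)
  apply: (@cvg_seq_telescope _ _ _ (fun n => r ^+ 2 * y n) (r ^+ 2)) => [n m nm|n|n m nm].
  - by rewrite ler_wpM2l ?sqr_ge0// sqrt_majorant_homo.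
  - by rewrite ler_piMr ?sqr_ge0// sqrt_majorant_le1.
  have := sqrt_iter_sub_le x nm; rewrite -xr -rmorphM => h.
  apply: (le_trans (_ : _ <= ((y m - y n) * r)%:C%C ^+ 2)).
    by rewrite ler_pXn2r ?nnegrE// (le_trans _ h).
  rewrite -rmorphXn lecR exprMn -mulrBr mulrC ler_wpM2l ?sqr_ge0//.
  have := sqrt_majorant_homo nm; have := sqrt_majorant_le1 m.
  by have := sqrt_majorant_ge0 n; nra.
have [L YL] := strong_limit Y1 YK.
have Ls : selfadjoint L by apply: limit_selfadjoint YL; exact: sqrt_iter_selfadjoint.
have L1 x : `|L x| <= `|x|.
  apply: (norm_lim_le (YL x) (cvg_cst x)) => n.
  by rewrite (le_trans (Y1 _ _))// rmorph1 mul1r.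
have LL : L = 2^-1 *: (K + L * L).
  apply: bounded_opP => x; rewrite !opE.
  have YYL : Y n (Y n x) @[n --> \oo] --> L (L x).
    apply/cvgrPdist_le => e e0.
    have e2 : 0 < e / 2 by rewrite divr_gt0.
    have [N1 h1] := cvg_seqP (YL x) e2.
    have [N2 h2] := cvg_seqP (YL (L x)) e2.
    exists (maxn N1 N2) => // n /=; rewrite geq_max => /andP[/h1 {}h1 /h2 {}h2].
    rewrite (_ : _ - _ = (L (L x) - Y n (L x)) + Y n (L x - Y n x)); last first.
      by rewrite opB addrA subrK.
    rewrite (le_trans (ler_normD _ _))// [leRHS]splitr lerD//.
    by rewrite (le_trans (Y1 _ _))// rmorph1 mul1r.
  apply: (@cvg_seq_unique _ _ (fun n => Y n.+1 x)).
    by rewrite (cvg_shiftS (fun n => Y n x)); exact: YL.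
  rewrite [X in X @ _](_ : _ = fun n => 2^-1 *: (x - A x + Y n (Y n x)))//.
  apply: cvgZr; apply: cvgD => //; exact: cvg_cst.
exists (1 - L); split.
- move=> x; rewrite !opE innerBl.
  have Lx : inner (L x) x \is Num.real by apply/CrealP; rewrite -innerC -Ls.
  rewrite subr_ge0 (le_trans (real_ler_norm Lx))// (le_trans (cauchy_schwarz _ _))//.
  by rewrite inner_normE expr2 ler_wpM2r.
(* The fixed point equation gives [(1 - L)^2 = 1 - (L + L) + L * L = 1 - K = A]. *)
- have : L + L = K + L * L.
    rewrite {1 2}LL -scalerDl -[X in X *: _](_ : 1 = _) ?scale1r//.
    by field.
  rewrite mulrBl mul1r mulrBr mulr1 /K => h.
  by rewrite opprB addrACA -opprD h opprD addrACA subrr addr0 subKr.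
- move=> Z AZ; rewrite mulrBl mulrBr mul1r mulr1; congr (_ - _).
  apply: bounded_opP => x; rewrite !opE.
  apply: (@cvg_seq_unique _ _ (fun n => Y n (Z x))); first exact: YL.
  rewrite (_ : (fun n => _) = fun n => Z (Y n x)).
    have := @bounded_op_continuous _ _ Z (L x).
    by move=> /continuous_cvg; apply.
  by apply/funext => n; rewrite -!op_mulE sqrt_iter_commute.
Qed.

End ContractionSqrt.

(** * Existence and uniqueness of positive square roots *)

Lemma op_scaleAl (a : R[i]) S T : (a *: S) * T = a *: (S * T).
Proof. exact: bounded_opP. Qed.

Lemma op_scaleAr (a : R[i]) S T : S * (a *: T) = a *: (S * T).
Proof. by apply: bounded_opP => x; rewrite !opE opZ. Qed.

Lemma sqrt_exists A : positive_op A -> exists B,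
  [/\ positive_op B, B * B = A & forall Z, A * Z = Z * A -> B * Z = Z * B].
Proof.
move=> A0; have [M M0 AM] := op_bound A.
have MC0 : 0 < M%:C%C by rewrite ltcR.
have [||B [B0 BB BZ]] := @contraction_sqrt (M%:C%C^-1 *: A).
- by move=> x; rewrite opE innerZl mulr_ge0 ?invr_ge0 ?A0 ?(ltW MC0).
- move=> x; rewrite opE normrZ ger0_norm ?invr_ge0 ?(ltW MC0)//.
  by rewrite ler_pdivrMl.
(* [B] is the root of the contraction [M^-1 A]. *)
exists ((Num.sqrt M)%:C%C *: B); split.
- by move=> x; rewrite opE innerZl mulr_ge0 ?ler0c ?sqrtr_ge0.
- rewrite op_scaleAl op_scaleAr scalerA BB scalerA -rmorphM /= -expr2.
  by rewrite sqr_sqrtr ?(ltW M0)// mulfV ?scale1r// gt_eqF.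
- move=> Z AZ; rewrite op_scaleAl op_scaleAr BZ//.
  by rewrite op_scaleAl op_scaleAr AZ.
Qed.

(** [C] commutes with [C * C = B * B], hence with [B], so [B + C] vanishes at [y = (B - C) x]. By
    positivity [B y = C y = 0], and [|y|^2 = <x, (B - C) y> = 0]. *)
Lemma sqrt_unique B C : positive_op B -> positive_op C ->
  B * B = C * C ->
  (forall Z, B * B * Z = Z * (B * B) -> B * Z = Z * B) -> B = C.
Proof.
move=> B0 C0 BC BZ.
have comm : B * C = C * B by apply: BZ; rewrite BC mulrA.
apply: bounded_opP => x; apply/eqP; rewrite -subr_eq0.
set y := B x - C x.
have BCy : B y + C y = 0.
  rewrite /y !opB -!op_mulE comm BC addrC.
  by rewrite subrKA subrr.
have inner_sum : inner (B y) y + inner (C y) y = 0.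
  by rewrite -innerDl BCy inner0l.
have /andP[/eqP By /eqP Cy] : (inner (B y) y == 0) && (inner (C y) y == 0).
  by rewrite -paddr_eq0 ?B0 ?C0// inner_sum.
have {}By := positive_inner_eq0 B0 By; have {}Cy := positive_inner_eq0 C0 Cy.
apply/eqP/inner_eq0; rewrite {1}/y innerBl.
rewrite (positive_selfadjoint B0) (positive_selfadjoint C0) By Cy.
by rewrite inner0r subrr.
Qed.

(** [xget] only supplies positivity and the square; uniqueness identifies [op_sqrt A] with the
    constructed root, and the commutation property is inherited from there. *)
Lemma op_sqrtP A : positive_op A ->
  [/\ positive_op (op_sqrt A), op_sqrt A * op_sqrt A = A &
      forall Z, A * Z = Z * A -> op_sqrt A * Z = Z * op_sqrt A].
Proof.
move=> A0; have [B [B0 BB BZ]] := sqrt_exists A0.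
have [C0 CC] : positive_op (op_sqrt A) /\ op_sqrt A * op_sqrt A = A.
  by rewrite /op_sqrt; case: xgetP => [C _ //|/(_ B)]; case.
suff -> : op_sqrt A = B by [].
by apply/esym/sqrt_unique; rewrite ?BB ?CC.
Qed.

End PositiveOperators.

(** * Powers of a positive contraction and the polar decomposition *)

Section PolarDecomposition.
Context (R : realType) (H : hilbertType R).
Implicit Types (x y z : H) (S T A P U C : 'B(H)).

Section PositiveContraction.
Context (C : 'B(H)) (C0 : positive_op C) (C1 : forall x, `|C x| <= `|x|).

Lemma pow_norm_le n x : `|(C ^+ n) x| <= `|x|.
Proof.
elim: n => [|n IH]; first by rewrite expr0.
by rewrite exprS opE (le_trans (C1 _)).
Qed.

Lemma pow_selfadjoint n : selfadjoint (C ^+ n).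
Proof.
elim: n => [|n IH] x y; first by rewrite expr0.
by rewrite {1}exprS opE positive_selfadjoint// IH -op_mulE -exprSr.
Qed.

(** With [k] half of [n], the power is [C^k C^k] or [C^k C C^k], and one factor [C^k] moves to the
    other side of the inner product. *)
Lemma pow_positive n : positive_op (C ^+ n).
Proof.
move=> x; rewrite -(odd_double_half n) addnC -addnn !exprD.
case: (odd n); rewrite ?expr1 ?expr0 ?mulr1; last first.
  exact/positive_square/pow_selfadjoint.
rewrite -mulrA -exprSr exprS !op_mulE pow_selfadjoint.
exact: C0.
Qed.

Let y x n := - complex.Re (`|(C ^+ n) x| ^+ 2).

(** For [v = C^n x] and [F = C^(m - n)], the inequality [|Fv|^2 <= <Fv, v>] turns [|Fv - v|^2] into
    at most [|v|^2 - |Fv|^2]. *)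
Lemma pow_sub_le x n m : (n <= m)%N ->
  `|(C ^+ m) x - (C ^+ n) x| ^+ 2 <= (y x m - y x n)%:C%C.
Proof.
move=> nm; have yE k : (y x k)%:C%C = - `|(C ^+ k) x| ^+ 2.
  by rewrite rmorphN /= RRe_real// realX// normr_real.
rewrite rmorphB /= !yE opprK -(subnK nm) exprD op_mulE.
set v := (C ^+ n) x; set F := C ^+ (m - n).
have F1 z : `|F z| <= 1%:C%C * `|z| by rewrite rmorph1 mul1r pow_norm_le.
have := positive_normsq_le (pow_positive (m - n)) ltr01 F1 v.
rewrite rmorph1 mul1r -!inner_normE !(innerBl, innerBr) -/F => h.
rewrite -(pow_selfadjoint (m - n) v) -/F -subr_ge0.
rewrite [leRHS](_ : _ = 2 * (inner (F v) v - inner (F v) (F v))); last by ring.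
by rewrite mulr_ge0// subr_ge0.
Qed.

(** Only the norms of the increments matter: this covers the powers themselves and the approximants
    of the polar part. *)
Lemma cvg_seq_pow (u : nat -> H) x :
  (forall n m, `|u m - u n| = `|(C ^+ m) x - (C ^+ n) x|) ->
  exists l : H, u @ \oo --> l.
Proof.
move=> uC; apply: (@cvg_seq_telescope _ _ _ (y x) 0) => [n m nm|n|n m nm].
- by rewrite -subr_ge0 -ler0c (le_trans _ (pow_sub_le x nm))// exprn_ge0.
- by rewrite oppr_le0 -ler0c RRe_real ?exprn_ge0// realX// normr_real.
- by rewrite uC pow_sub_le.
Qed.

(** [E] is the orthogonal projection onto the fixed vectors of [C]; for [C = 1 - cP] these form the
    kernel of [P]. *)
Lemma pow_limit : exists E : 'B(H),
  [/\ forall x, (C ^+ n) x @[n --> \oo] --> E x, selfadjoint E & C * E = E].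
Proof.
have [|x|E CE] := @strong_limit _ _ (fun n => C ^+ n) 1.
- by move=> n x; rewrite rmorph1 mul1r pow_norm_le.
- exact: cvg_seq_pow.
exists E; split => //; first exact: limit_selfadjoint pow_selfadjoint CE.
apply: bounded_opP => x; rewrite opE.
apply: (@cvg_seq_unique _ _ (fun n => (C ^+ n.+1) x)); last first.
  by rewrite (cvg_shiftS (fun n => (C ^+ n) x)); exact: CE.
rewrite (_ : (fun n => _) = fun n => C ((C ^+ n) x)).
  have := @bounded_op_continuous _ _ C (E x).
  by move=> /continuous_cvg; apply.
by apply/funext => n; rewrite exprS opE.
Qed.

End PositiveContraction.

(* With [C = 1 - cP] a positive contraction, [P * c(1 + C + ... + C^(n-1)) =
   1 - C^n] converges strongly to the projection onto the closed range of [P],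
   so [T * c(1 + C + ... + C^(n-1))] converges strongly to the polar part. *)
Lemma polar_exists T P : positive_op P -> P * P = adjoint T * T ->
  exists U, [/\ partial_isometry U, op_ker U = op_ker T & T = U * P].
Proof.
move=> P0 PP.
have TP x : `|T x| = `|P x|.
  apply/eqP; rewrite -(@eqrXn2 _ 2)// -!inner_normE.
  by rewrite adjointP (positive_selfadjoint P0) -[P (P x)]op_mulE PP.
have [M M0 PM] := op_bound P.
have MC0 : 0 < M%:C%C by rewrite ltcR.
pose c : R[i] := M%:C%C^-1.
have c0 : 0 < c by rewrite invr_gt0.
have cP0 : positive_op (c *: P).
  by move=> x; rewrite opE innerZl mulr_ge0 ?P0 ?(ltW c0).
have cP1 x : `|(c *: P) x| <= `|x|.
  by rewrite opE normrZ gtr0_norm// /c ler_pdivrMl.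
pose C := 1 - c *: P.
have C1 x : `|C x| <= `|x| by exact: contraction_compl.
have C0 : positive_op C.
  move=> x; rewrite !opE innerBl subr_ge0 -[leLHS]ger0_norm ?cP0//.
  by rewrite (le_trans (cauchy_schwarz _ _))// inner_normE expr2 ler_wpM2r//; exact: cP1.
have cPC : c *: P = 1 - C by rewrite subKr.
have CE x : C x = x - c *: P x by [].
clearbody C.
pose Q n := \sum_(k < n) C ^+ k.
have PQ n : (c *: P) * Q n = 1 - C ^+ n.
  elim: n => [|n IH]; first by rewrite /Q big_ord0 mulr0 expr0 subrr.
  rewrite /Q big_ord_recr /= mulrDr -/(Q n) IH cPC mulrBl mul1r -exprS.
  by rewrite addrA subrK.
have QP n : Q n * (c *: P) = 1 - C ^+ n.
  elim: n => [|n IH]; first by rewrite /Q big_ord0 mul0r expr0 subrr.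
  rewrite /Q big_ord_recr /= mulrDl -/(Q n) IH cPC mulrBr mulr1 -exprSr.
  by rewrite addrA subrK.
pose V n := c *: (T * Q n).
have PV : forall n x, P (c *: Q n x) = x - (C ^+ n) x.
  by move=> n x; rewrite opZ -op_mulE -op_scaleE -op_scaleAl PQ.
have VE n x : V n x = T (c *: Q n x) by rewrite opZ.
have normV n x : `|V n x| = `|x - (C ^+ n) x| by rewrite VE TP PV.
have [E [powE Es CEE]] := pow_limit C0 C1.
have EP x : P (E x) = 0.
  have : (c *: P) (E x) = 0 by rewrite cPC !opE -[C (E x)]op_mulE CEE subrr.
  by rewrite opE => /eqP; rewrite scaler_eq0 gt_eqF//= => /eqP.
have ET x : T (E x) = 0 by apply/eqP; rewrite -normr_eq0 TP EP normr0.
have kerC x : P x = 0 -> forall n, (C ^+ n) x = x.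
  move=> Px; elim=> [|n IH]; first by rewrite expr0.
  by rewrite exprSr opE CE Px scaler0 subr0.
have kerE x : P x = 0 -> E x = x.
  move=> Px; apply: (cvg_seq_unique (powE x)).
  rewrite (_ : (fun n => _) = fun=> x); first exact: cvg_cst.
  by apply/funext => n; rewrite kerC.
have [||U VU] := @strong_limit _ _ V 2.
- move=> n x; rewrite normV (le_trans (ler_normB _ _))// rmorph_nat mulr_natl mulr2n lerD//.
  exact: pow_norm_le.
(* By [TP] and [PV], the increments of [V n x] have the same norms as those of [C^n x]. *)
- move=> x; apply: (@cvg_seq_pow C C0 C1 _ x) => n m.
  rewrite !VE -opB TP opB !PV distrC; congr `| _ |.
  by rewrite opprB addrC addrA subrK.
have normU x : `|U x| = `|x - E x|.
  have h1 : V n x @[n --> \oo] --> U x by [].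
  have h2 : x - (C ^+ n) x @[n --> \oo] --> x - E x.
    by apply: cvgB; [exact: cvg_cst|exact: powE].
  by apply: (norm_lim_eq h1 h2) => n; exact: normV.
have kerU x : op_ker U x <-> P x = 0.
  split => [Ux|Px]; last first.
    by rewrite /op_ker /=; apply/eqP; rewrite -normr_eq0 normU kerE// subrr normr0.
  move/eqP: (normU x); rewrite Ux normr0 eq_sym normr_eq0 subr_eq0 => /eqP ->.
  exact: EP.
exists U; split.
- move=> x xU; rewrite normU.
  (* [E x] lies in the kernel of [U] and is fixed by [E], so [<Ex, Ex> = <x, Ex> = 0]. *)
  suff /inner_eq0 -> : inner (E x) (E x) = 0 by rewrite subr0.
  by rewrite Es kerE//; apply: xU; apply/kerU.
- apply/seteqP; split => x.
    move=> /kerU Px; apply/eqP; rewrite -normr_eq0 TP Px normr0 //.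
  move=> Tx; apply/kerU/eqP; rewrite -normr_eq0 -TP Tx normr0 //.
- apply: bounded_opP => x; rewrite opE.
  (* [V n (P x) = T x - T (C^n x)] tends to [T x - T (E x) = T x]. *)
  apply: (@cvg_seq_unique _ _ (fun n => V n (P x))); last exact: VU.
  rewrite (_ : (fun n => _) = fun n => T x - T ((C ^+ n) x)).
    rewrite -[X in _ --> X]subr0 -(ET x).
    apply: cvgB; first exact: cvg_cst.
    have := @bounded_op_continuous _ _ T (E x).
    by move=> /continuous_cvg; apply; exact: powE.
  apply/funext => n; rewrite VE -opB; congr (T _).
  by rewrite -opZ -op_scaleE -op_mulE QP.
Qed.

End PolarDecomposition.

(** * The fixed point equation of the power mean transform *)

Section PowerMean.
Context (R : realType) (H : hilbertType R).
Implicit Types (x y z : H) (S T A P U D : 'B(H)).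

Lemma op_absP T :
  [/\ positive_op (op_abs T), op_abs T * op_abs T = adjoint T * T &
      forall Z, adjoint T * T * Z = Z * (adjoint T * T) ->
        op_abs T * Z = Z * op_abs T].
Proof.
apply: op_sqrtP => x.
by rewrite opE (is_adjoint_sym (adjointP T)) inner_ge0.
Qed.

Lemma polar_partP T :
  op_ker (polar_part T) = op_ker T /\ T = polar_part T * op_abs T.
Proof.
have [P0 PP _] := op_absP T; have [U [Up Uk UT]] := polar_exists P0 PP.
by rewrite /polar_part; case: xgetP => [V _ [_ Vk VT]|/(_ U)]; last case.
Qed.

Lemma op_abs_ker T x : op_abs T x = 0 -> T x = 0.
Proof. by have [_ {2}-> ] := polar_partP T; rewrite opE => ->; rewrite linear0. Qed.

Lemma positive_square_eq0 A x : positive_op A -> A (A x) = 0 -> A x = 0.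
Proof.
move=> A0 AAx; apply: inner_eq0.
by rewrite positive_selfadjoint// AAx inner0r.
Qed.

(* The range of [P] and its kernel span a dense subspace; algebraically,
   [D * P = 0] gives [P * D^* = 0], hence [D * D^* = 0]. *)
Lemma eq0_on_range_ker P D : selfadjoint P -> D * P = 0 ->
  (forall x, P x = 0 -> D x = 0) -> D = 0.
Proof.
move=> Ps DP Dker; have Da := adjointP D.
have PD y : P (adjoint D y) = 0.
  apply: inner_ext => z.
  by rewrite Ps (is_adjoint_sym Da) -op_mulE DP inner0r inner0l.
have D'0 y : adjoint D y = 0.
  by apply: inner_eq0; rewrite (is_adjoint_sym Da) Dker// inner0r.
apply: bounded_opP => x; apply: inner_ext => z.
by rewrite Da D'0 inner0r inner0l.
Qed.

(** Applied to [X = U A A], [Y = A U A], [Z = A A U], for which [Y - X = D A] and [Z - Y = A D]. *)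
Lemma power_mean_factor (V : lmodType R[i]) (k l : R[i]) (X Y Z : V) :
  (1 - k) *: X + l *: Z + (k - l) *: Y = X ->
  k *: (Y - X) + l *: (Z - Y) = 0.
Proof.
move=> /eqP; rewrite -subr_eq0 => /eqP <-.
rewrite !scalerBr !scalerBl scale1r [RHS]addrC !addrA addNr add0r.
by rewrite -[k *: Y - _ + _]addrA [k *: Y + _]addrC.
Qed.

Lemma intertwiner_eq0 A D (a b : R) : 0 < a -> 0 < b -> positive_op A ->
  a%:C%C *: (D * A) + b%:C%C *: (A * D) = 0 -> D * A = 0.
Proof.
move=> a0 b0 A0 DA.
have As := positive_selfadjoint A0.
have Da := adjointP D; have aD := is_adjoint_sym Da.
set D' := adjoint D in Da aD.
have realC (r : R) : (r%:C%C)^* = r%:C%C :> R[i].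
  by apply/CrealP/complex_realP; exists r.
have DAx x : a%:C%C *: D (A x) = - (b%:C%C *: A (D x)).
  by apply/eqP; rewrite -addr_eq0; apply/eqP; exact: (congr1 (fun T : 'B(H) => T x) DA).
have ADx x : a%:C%C *: A (D' x) = - (b%:C%C *: D' (A x)).
  apply: inner_ext => z.
  have := congr1 (inner x) (DAx z).
  rewrite -!scaleNr !innerZr !innerZl rmorphN /= !realC.
  by rewrite As !aD As.
(* The constants cancel: [a A D' D = - b D' A D = a D' D A]. *)
have comm : A * (D' * D) = (D' * D) * A.
  apply: bounded_opP => x; rewrite !opE.
  apply: (scalerI (_ : a%:C%C != 0)); first by rewrite gt_eqF// ltcR.
  by rewrite ADx -[a%:C%C *: D' _]opZ DAx opN opZ.
have [B0 BB BZ] := op_sqrtP A0.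
set B := op_sqrt A in B0 BB BZ.
have Bs := positive_selfadjoint B0.
apply: bounded_opP => x.
suff DB y : D (B y) = 0 by rewrite -BB !opE DB.
have BD z : B (D' (D z)) = D' (D (B z)) by have := congr1 (fun S : 'B(H) => S z) (BZ _ comm).
have DBE : inner (D (B y)) (D (B y)) = inner y (D' (D (A y))).
  by rewrite Da Bs BD -[B (B y)]op_mulE BB.
(* The left side is [<y, D' (a D A y)> = - b <A (D y), D y>]. *)
have : a%:C%C * inner (D (B y)) (D (B y)) <= 0.
  rewrite DBE -(realC a) -innerZr -opZ DAx -scaleNr opZ innerZr -Da -As.
  by rewrite rmorphN /= realC mulNr oppr_le0 mulr_ge0 ?A0// ler0c ltW.
rewrite pmulr_rle0 ?ltcR// => h; apply: inner_eq0.
by apply/eqP; rewrite eq_le h inner_ge0.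
Qed.

End PowerMean.

Theorem theorem3p2 (R : realType) (H : hilbertType R) (lam : R)
    (lam_gt0 : 0 < lam) (lam_le1 : lam <= 1) (T : 'B(H)) :
  power_mean lam T = T <-> quasinormal T.
Proof.
have [P0 PP PZ] := op_absP T; have [Uker TUP] := polar_partP T.
rewrite /power_mean /duggal /aluthge /quasinormal.
have [A0 AA AZ] := op_sqrtP P0.
have kerT := @op_abs_ker R H T.
set P := op_abs T in P0 PP PZ TUP A0 AA AZ kerT *.
set U := polar_part T in Uker TUP *.
set A := op_sqrt P in A0 AA AZ *.
have As := positive_selfadjoint A0.
have Ux x : P x = 0 -> U x = 0 by move=> /kerT Tx; have : op_ker T x by []; rewrite -Uker.
clearbody A P U.
rewrite -PP; split => [pm|TPP].
  pose D := A * U - U * A.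
  have DA : (2 - lam)%:C%C *: (D * A) + lam%:C%C *: (A * D) = 0.
    (* After multiplication by [lam] the coefficients are [lam (2 - lam) = 1 - (1 - lam)^2] and
       [lam^2], as [power_mean_factor] expects; their difference is [2 lam (1 - lam)]. *)
    apply: (scalerI (_ : lam%:C%C != 0)); first by rewrite gt_eqF// ltcR.
    rewrite scaler0 scalerDr !scalerA -!rmorphM /D mulrBl [A * (_ - _)]mulrBr !mulrA.
    apply: power_mean_factor; rewrite -[U * A * A]mulrA !AA -TUP -[RHS]pm.
    congr (_ *: _ + _ *: _ + _ *: _).
    - by rewrite -(rmorph1 (real_complex R)) -rmorphB; congr (_%:C%C); ring.
    - by rewrite -rmorphB; congr (_%:C%C); ring.
  have l2 : 0 < 2 - lam by lra.
  have {}DA := intertwiner_eq0 l2 lam_gt0 A0 DA.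
  have /eqP : D = 0.
    apply: (eq0_on_range_ker As DA) => x Ax.
    have Px : P x = 0 by rewrite -AA opE Ax linear0.
    by rewrite /D !opE Ax Ux// !linear0 addr0.
  rewrite subr_eq0 => /eqP AU.
  have TA : T * A = A * T by rewrite TUP -AA !mulrA AU.
  have TP : T * P = P * T by rewrite -AA mulrA TA -mulrA TA mulrA.
  by rewrite mulrA TP -mulrA TP mulrA.
have TP : T * P = P * T by rewrite PZ// -PP TPP.
have TA : A * T = T * A by rewrite AZ.
have AU : A * U = U * A.
  apply/eqP; rewrite -subr_eq0; apply/eqP.
  (* On the range of [P], [(A U - U A) P = A T - T A = 0]; on its kernel both [A] and [U] vanish. *)
  apply: (eq0_on_range_ker (positive_selfadjoint P0)) => [|x Px].
    by rewrite mulrBl -!mulrA -TUP [A * P]AZ// mulrA -TUP TA subrr.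
  have Ax : A x = 0 by apply: positive_square_eq0; rewrite // -op_mulE AA.
  by rewrite !opE Ax Ux// !linear0 addr0.
have PU : P * U = T by rewrite [RHS]TUP -AA -mulrA AU mulrA AU mulrA.
rewrite PU AU -[U * A * A]mulrA AA -TUP -!scalerDl -!rmorphD /=.
rewrite [X in X%:C%C](_ : _ = 1); last by ring.
by rewrite rmorph1 scale1r.
Qed.
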